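(* Let $\mu\in\mathcal{P}(\Theta)$ and let $(\mu_k)_{k\ge1}\subseteq\mathcal{P}(\Theta)$ converge weakly to $\mu$. Let $\bar x_0\colon\Theta\to X$. Assume the following. (1) There exist $\alpha_x,\alpha_u\in\mathcal{K}_\infty$ such that for all $\theta\in\Theta$, $x,x'\in X$, $u,u'\in U$: $d_X(f(x,u,\theta),f(x',u',\theta))\le \alpha_x(d_X(x,x'))+\alpha_u(d_U(u,u'))$. (2) (i) There exist $\gamma_x,\gamma_u\in\mathcal{K}_\infty$ such that $|\ell_0(x,u,\theta)-\ell_0(x',u',\theta)|\le\gamma_x(d_X(x,x'))+\gamma_u(d_U(u,u'))$ for all $x,x'\in X$, $u,u'\in U$, $\theta\in\Theta$; (ii) $\ell_u$ is lower semicontinuous; (iii) there exists $\gamma_N\in\mathcal{K}_\infty$ such that $|F_N(x,\theta)-F_N(x',\theta)|\le\gamma_N(d_X(x,x'))$ for all $x,x'\in X$, $\theta\in\Theta$. (3) The maps $\bar x_0$, $f$, $\ell_0$ and $F_N$ are continuous. (4) For all $\underline{u}\in U^N$ and $n=0,\dots,N-1$, $$\lim_{k}\int_\Theta\ell_0(\phi_{\underline{u}}^\theta(n),\underline{u}(n),\theta)\,\mathrm{d}\mu_k(\theta)=\int_\Theta\ell_0(\phi_{\underline{u}}^\theta(n),\underline{u}(n),\theta)\,\mathrm{d}\mu(\theta),$$ and $$\lim_k\int_\Theta F_N(\phi_{\underline{u}}^\theta(N),\theta)\,\mathrm{d}\mu_k(\theta)=\int_\Theta F_N(\phi_{\underline{u}}^\theta(N),\theta)\,\mathrm{d}\mu(\theta).$$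 Then the sequence of functionals $(\bar J_N(\bar x_0,\cdot,\mu_k))_{k\ge1}$ is $\Gamma$-convergent to the functional $U^N\ni\underline{u}\mapsto\bar J_N(\bar x_0,\underline{u},\mu)$ with respect to the product topology of $U^N$.
   Context: $(X,d_X)$, $(U,d_U)$, $(\Theta,d_\Theta)$ are metric spaces with their Borel $\sigma$-algebras; $\mathcal{P}(\Theta)$ is the set of Borel probability measures on $\Theta$; $N\ge1$ is an integer. $\mu_k$ converges weakly to $\mu$ if $\int\varphi\,\mathrm{d}\mu_k\to\int\varphi\,\mathrm{d}\mu$ for all bounded continuous $\varphi\colon\Theta\to\mathbb{R}$. $f\colon X\times U\times\Theta\to X$ is a transition function. The stage cost $\ell\colon X\times U\times\Theta\to\mathbb{R}_{\ge0}$ has the form $\ell(x,u,\theta)=\ell_u(u)+\ell_0(x,u,\theta)$ with $\ell_u\colon U\to\mathbb{R}_{\ge0}$, $\ell_0\colon X\times U\times\Theta\to\mathbb{R}_{\ge0}$; the terminal cost is $F_N\colon X\times\Theta\to\mathbb{R}_{\ge0}$. For $x_0\in X$, $\theta\in\Theta$ and $\underline{u}=(\underline{u}(0),\dots,\underline{u}(N-1))\in U^N$, the trajectory is defined by $\phi_{\underline{u},x_0}^\theta(0)=x_0$, $\phi_{\underline{u},x_0}^\theta(n+1)=f(\phi_{\underline{u},x_0}^\theta(n),\underline{u}(n),\theta)$ for $0\le n<N$; given $\bar x_0\colon\Theta\to X$, write $\phi_{\underline{u}}^\theta(n)=\phi_{\underline{u},\bar x_0(\theta)}^\theta(n)$.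 The total cost is $$J_N(x_0,\underline{u},\theta)=\sum_{n=0}^{N-1}\ell(\phi_{\underline{u},x_0}^\theta(n),\underline{u}(n),\theta)+F_N(\phi_{\underline{u},x_0}^\theta(N),\theta),$$ and for $\nu\in\mathcal{P}(\Theta)$ the averaged cost is $\bar J_N(\bar x_0,\underline{u},\nu)=\int_\Theta J_N(\bar x_0(\theta),\underline{u},\theta)\,\mathrm{d}\nu(\theta)\in\mathbb{R}_{\ge0}\cup\{\infty\}$. $\mathcal{K}_\infty$ is the set of continuous, strictly increasing $\alpha\colon\mathbb{R}_{\ge0}\to\mathbb{R}_{\ge0}$ with $\alpha(0)=0$ and $\lim_{r\to\infty}\alpha(r)=\infty$. A function $g\colon Z\to\mathbb{R}\cup\{\infty\}$ on a metric space is lower semicontinuous if $g(z)\le\liminf_k g(z_k)$ whenever $z_k\to z$. $\Gamma$-convergence: functionals $\mathcal{F}_k\colon Z\to\mathbb{R}\cup\{+\infty\}$ on a metric space $Z$ $\Gamma$-converge to $\mathcal{F}\colon Z\to\mathbb{R}\cup\{+\infty\}$ if (a) for every $z\in Z$ and every sequence $z_k\to z$, $\mathcal{F}(z)\le\liminf_k\mathcal{F}_k(z_k)$; and (b) for every $z\in Z$ there is a sequence $\bar z_k\to z$ with $\mathcal{F}(z)\ge\limsup_k\mathcal{F}_k(\bar z_k)$. Here $Z=U^N$ with any metric inducing the product topology. *)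

(* Defs.v *)
(* MathComp-Analysis development, over an arbitrary R : realType. *)
From HB Require Import structures.
From mathcomp Require Import all_boot all_order all_algebra.
From mathcomp Require Import all_classical all_reals all_analysis.

Set Implicit Arguments.
Unset Strict Implicit.
Unset Printing Implicit Defensive.

Import Order.TTheory GRing.Theory Num.Theory.
Import numFieldNormedType.Exports.

Local Open Scope classical_set_scope.
Local Open Scope ring_scope.

(* Measurable types are pointed in the library, whereas metric spaces may be
   empty.  A space carrying a probability measure is nonempty, so pointedness
   is harmless for the parameter space. *)
#[short(type="pmetricType")]
HB.structure Definition PointedMetric (K : numDomainType) :=
  { M of Metric K M & Pointed M }.

Notation borel T := (g_sigma_algebraType (@open T)).

(* Only the restriction of alpha to [0, +oo[ is constrained; it is
   nonnegative there because alpha 0 = 0 and alpha is increasing. *)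
Definition class_Kinfty (R : realType) (alpha : R -> R) : Prop :=
  [/\ {within `[0, +oo[%classic, continuous alpha},
      {in `[0, +oo[ &, {homo alpha : r s / r < s}},
      alpha 0 = 0
    & alpha r @[r --> +oo] --> +oo].

Definition weakly_converges (R : realType) (T : pmetricType R)
    (mu_ : nat -> probability (borel T) R) (mu : probability (borel T) R) :
    Prop :=
  forall phi : T -> R, continuous phi -> bounded_fun phi ->
    (\int[mu_ k]_x (phi x)%:E)%E @[k --> \oo] --> (\int[mu]_x (phi x)%:E)%E.

(* The sequential definition; in a metric space it depends on the metric only
   through the topology. *)
Definition Gamma_converges (R : realType) (Z : topologicalType)
    (F_ : nat -> Z -> \bar R) (F : Z -> \bar R) : Prop :=
  (forall (z : Z) (z_ : nat -> Z), z_ k @[k --> \oo] --> z ->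
     (F z <= limn_einf (fun k => F_ k (z_ k)))%E) /\
  (forall z : Z, exists2 zbar_ : nat -> Z, zbar_ k @[k --> \oo] --> z &
     (limn_esup (fun k => F_ k (zbar_ k)) <= F z)%E).

(* The state at time n for the input sequence u; only the times n <= N are
   meaningful, beyond which the trajectory is frozen (insub n = None). *)
Fixpoint trajectory (X U Theta : Type) (N : nat) (f : X * U * Theta -> X)
    (u : 'I_N -> U) (x0 : X) (theta : Theta) (n : nat) : X :=
  if n is m.+1 then
    let x := trajectory f u x0 theta m in
    if insub m is Some i then f (x, u i, theta) else x
  else x0.

Definition total_cost (R : realType) (X U Theta : Type) (N : nat)
    (f : X * U * Theta -> X) (ell : X * U * Theta -> R) (F_N : X * Theta -> R)
    (x0 : X) (u : 'I_N -> U) (theta : Theta) : R :=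
  \sum_(n < N) ell (trajectory f u x0 theta n, u n, theta) +
  F_N (trajectory f u x0 theta N, theta).

Definition averaged_cost (R : realType) (X U : Type) (Theta : pmetricType R)
    (N : nat) (f : X * U * Theta -> X) (ell : X * U * Theta -> R)
    (F_N : X * Theta -> R) (x0bar : Theta -> X) (u : 'I_N -> U)
    (nu : probability (borel Theta) R) : \bar R :=
  (\int[nu]_theta (total_cost f ell F_N (x0bar theta) u theta)%:E)%E.

(* Main.v *)
(* If u_k --> u, the moduli of continuity, being independent of theta, make the
   trajectories and hence ell_0 and F_N along them converge uniformly in theta;
   together with the lower semicontinuity of ell_u this gives, for each e > 0,
   J_N(u, theta) <= J_N(u_k, theta) + e for all theta and all large k.
   Integrating against mu_k and using the convergence of the averaged costs at
   the fixed control u, which is assumption (4), yields the liminf inequality.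
   The constant sequence is a recovery sequence, again by (4). *)
Require Import Defs.
From HB Require Import structures.
From mathcomp Require Import all_boot all_order all_algebra.
From mathcomp Require Import all_classical all_reals all_analysis.
From mathcomp Require Import measurable_realfun.

Set Implicit Arguments.
Unset Strict Implicit.
Unset Printing Implicit Defensive.

Import Order.TTheory GRing.Theory Num.Theory.
Import numFieldNormedType.Exports.

Local Open Scope classical_set_scope.
Local Open Scope ring_scope.

(** * Moduli near zero, limits inferior, and measurability of continuous functions *)

Lemma class_Kinfty_near0 (R : realType) (alpha beta : R -> R) (e : R) :
  class_Kinfty alpha -> class_Kinfty beta -> 0 < e ->
  exists2 d, 0 < d &
    forall r s, 0 <= r < d -> 0 <= s < d -> alpha r + beta s < e.
Proof.
suff lt_half (a : R -> R) : class_Kinfty a -> 0 < e ->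
    exists2 d, 0 < d & forall r, 0 <= r < d -> a r < e / 2.
  move=> Ka Kb e0.
  have [d d0 da] := lt_half _ Ka e0; have [d' d'0 db] := lt_half _ Kb e0.
  exists (Num.min d d'); first by rewrite lt_min d0.
  move=> r s; rewrite !lt_min => /and3P[r0 rd _] /and3P[s0 _ sd].
  by rewrite [ltRHS]splitr ltrD ?da ?db ?r0 ?s0.
(* Continuity at [0] relative to [[0, +oo[] and [a 0 = 0] make [a] small on some [[0, d[]. *)
move=> [/subspace_continuousP ca _ a0 _] e0.
have /ca/cvgrPdist_lt : (`[0, +oo[%classic : set R) 0.
  by rewrite /= in_itv/= lexx.
move=> /(_ (e / 2)); rewrite /from_subspace a0 divr_gt0//.
move=> /(_ isT) /nbhs_ballP[d /= d0 dP].
exists d => // r /andP[r0 rd]; apply: le_lt_trans (ler_norm _) _.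
rewrite -normrN -sub0r; apply: dP; last by rewrite /= in_itv/= r0.
by rewrite /ball/= sub0r normrN ger0_norm.
Qed.

(** A lower limit is the limit of the infima over tails, and past the rank [m] each tail of [v]
    dominates that of [u] term by term. *)
Lemma le_limn_einf_near (R : realType) (u v : (\bar R)^nat) :
  (\forall k \near \oo, u k <= v k)%E -> (limn_einf u <= limn_einf v)%E.
Proof.
move=> [m _ uv]; rewrite !limn_einf_lim.
apply: lee_lim; [exact: is_cvg_einfs|exact: is_cvg_einfs|].
exists m => // n /= mn; apply: le_ereal_inf_tmp => _ [k /= nk <-].
apply: ge_ereal_inf; exists (u k); last by apply: uv; exact: leq_trans nk.
by exists k.
Qed.

(** Open intervals generate the Borel sets of [R], and their preimages under [g] are open, hence
    generators of [borel T]. *)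
Lemma continuous_borel_measurable (R : realType) (T : pmetricType R)
  (g : T -> R) : continuous g -> measurable_fun setT (g : borel T -> R).
Proof.
move=> /continuousP cg; apply: (measurability _ (RGenOpens.measurableE R)).
move=> _ [_ [a [b ->] <-]]; rewrite setTI; apply: sub_sigma_algebra.
exact/cg/interval_open.
Qed.

(** Supplies the Borel measurability in [theta] of the costs along a trajectory. *)
Lemma continuous_trajectory (R : realType) (X U : metricType R)
    (Theta : topologicalType) (N : nat) (f : X * U * Theta -> X)
    (x0bar : Theta -> X) (u : 'I_N -> U) (n : nat) :
  continuous f -> continuous x0bar ->
  continuous (fun theta => trajectory f u (x0bar theta) theta n).
Proof.
move=> cf cx; elim: n => [|n IH] //= theta.
case: insub => [i|]; last exact: IH.
apply: (@cvg_comp _ _ _ (fun t => (trajectory f u (x0bar t) t n, u i, t))).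
  exact: cvg_pair (cvg_pair (IH theta) (cvg_cst (u i))) cvg_id.
exact: cf.
Qed.

(** * Perturbation of the control, uniformly in the initial state and the parameter *)

Section pointwise_perturbation.
Context {R : realType} {X U : metricType R} {Theta : Type} {N : nat}.
Context {I : Type} {F : set_system I} {FF : Filter F}.
Variables (v : I -> 'I_N -> U) (u : 'I_N -> U).
Hypothesis vu : forall i, v k i @[k --> F] --> u i.
Variable f : X * U * Theta -> X.
Variables alpha_x alpha_u : R -> R.
Hypotheses (Kx : class_Kinfty alpha_x) (Ku : class_Kinfty alpha_u).
Hypothesis f_modulus : forall theta x x' w w',
  mdist (f (x, w, theta)) (f (x', w', theta)) <=
    alpha_x (mdist x x') + alpha_u (mdist w w').

(** Induction on time. The radius [d] given by the moduli depends on neither [x0] nor [theta], so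
    both can be quantified after [k]. *)
Lemma near_trajectory (n : nat) (e : R) : 0 < e ->
  \forall k \near F, forall x0 theta,
    mdist (trajectory f u x0 theta n) (trajectory f (v k) x0 theta n) < e.
Proof.
elim: n e => [|n IH] e e0 /=.
  by apply: nearW => k x0 theta; rewrite mdistxx.
(* Past the horizon the state is frozen and the previous bound carries over. *)
case: insub => [i|]; last exact: IH.
have [d d0 dP] := class_Kinfty_near0 Kx Ku e0.
have near_u := metricType_numDomainType.cvgr_dist_lt (@vu i) d0.
near=> k => x0 theta; apply: le_lt_trans (f_modulus _ _ _ _ _) _.
apply: dP; rewrite mdist_ge0/=; last by near: k; exact: near_u.
by move: x0 theta; near: k; exact: IH.
Unshelve. all: by end_near. Qed.

(** States and inputs are eventually [d]-close, so the moduli apply. A one-sided bound suffices,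
    matching what lower semicontinuity gives for [ell_u]. *)
Lemma near_stage_cost (ell_0 : X * U * Theta -> R) (gamma_x gamma_u : R -> R)
    (n : 'I_N) (e : R) :
  class_Kinfty gamma_x -> class_Kinfty gamma_u ->
  (forall x x' w w' theta, `|ell_0 (x, w, theta) - ell_0 (x', w', theta)| <=
     gamma_x (mdist x x') + gamma_u (mdist w w')) ->
  0 < e ->
  \forall k \near F, forall x0 theta,
    ell_0 (trajectory f u x0 theta n, u n, theta) <=
    ell_0 (trajectory f (v k) x0 theta n, v k n, theta) + e.
Proof.
move=> Kgx Kgu ell_0_modulus e0.
have [d d0 dP] := class_Kinfty_near0 Kgx Kgu e0.
have near_u := metricType_numDomainType.cvgr_dist_lt (@vu n) d0.
near=> k => x0 theta.
rewrite -lerBlDl; apply: le_trans (ler_norm _) _.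
apply: le_trans (ell_0_modulus _ _ _ _ _) _; apply/ltW/dP; rewrite mdist_ge0/=.
  by move: x0 theta; near: k; exact: near_trajectory.
by near: k; exact: near_u.
Unshelve. all: by end_near. Qed.

Lemma near_terminal_cost (F_N : X * Theta -> R) (gamma_N : R -> R) (e : R) :
  class_Kinfty gamma_N ->
  (forall x x' theta, `|F_N (x, theta) - F_N (x', theta)| <=
     gamma_N (mdist x x')) ->
  0 < e ->
  \forall k \near F, forall x0 theta,
    F_N (trajectory f u x0 theta N, theta) <=
    F_N (trajectory f (v k) x0 theta N, theta) + e.
Proof.
move=> KN F_N_modulus e0.
(* The single modulus fills both slots; the second is evaluated at [0], where [gamma_N] vanishes. *)
have [d d0 dP] := class_Kinfty_near0 KN KN e0.
near=> k => x0 theta.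
rewrite -lerBlDl; apply: le_trans (ler_norm _) _.
apply: le_trans (F_N_modulus _ _ _) _.
have [_ _ gamma0 _] := KN; rewrite -[leLHS]addr0 -[X in _ + X]gamma0.
apply/ltW/dP; rewrite ?lexx// mdist_ge0/=.
by move: x0 theta; near: k; exact: near_trajectory.
Unshelve. all: by end_near. Qed.

Lemma near_total_cost (ell ell_0 : X * U * Theta -> R) (ell_u : U -> R)
    (F_N : X * Theta -> R) (gamma_x gamma_u gamma_N : R -> R) (e : R) :
  class_Kinfty gamma_x -> class_Kinfty gamma_u -> class_Kinfty gamma_N ->
  (forall x w theta, ell (x, w, theta) = ell_u w + ell_0 (x, w, theta)) ->
  lower_semicontinuous (EFin \o ell_u) ->
  (forall x x' w w' theta, `|ell_0 (x, w, theta) - ell_0 (x', w', theta)| <=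
     gamma_x (mdist x x') + gamma_u (mdist w w')) ->
  (forall x x' theta, `|F_N (x, theta) - F_N (x', theta)| <=
     gamma_N (mdist x x')) ->
  0 < e ->
  \forall k \near F, forall x0 theta,
    total_cost f ell F_N x0 u theta <= total_cost f ell F_N x0 (v k) theta + e.
Proof.
move=> Kgx Kgu KN ellE lsc ell_0_modulus F_N_modulus e0.
(* The error [e] is shared equally by [2N + 1] terms: [N] values of [ell_u], [N] values of [ell_0],
   and one terminal cost. *)
pose d : R := e / N.*2.+1%:R.
have d0 : 0 < d by rewrite divr_gt0.
have near_ell_u (i : 'I_N) :
    \forall k \near F, ell_u (u i) <= ell_u (v k i) + d.
  (* Lower semicontinuity at the level [ell_u (u i) - d] yields a neighborhood [V] of [u i] on which
     [ell_u] exceeds that level. *)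
  have /lsc[V uV ltV] : ((ell_u (u i) - d)%:E < (ell_u (u i))%:E)%E.
    by rewrite lte_fin ltrBlDr ltrDl.
  have : \forall k \near F, V (v k i) by exact: vu.
  by apply: filterS => k /ltV; rewrite lte_fin ltrBlDr => /ltW.
have near_ell_0 (i : 'I_N) :=
  near_stage_cost i Kgx Kgu ell_0_modulus d0.
near=> k => x0 theta.
have -> : e = \sum_(i < N) (d + d) + d.
  rewrite sumr_const card_ord -mulr2n -mulrnA mul2n -mulrSr -mulr_natr.
  by rewrite /d divfK.
rewrite /total_cost addrACA -big_split/=; apply: lerD.
  apply: ler_sum => i _; rewrite !ellE addrACA; apply: lerD.
    (* There are finitely many stages, so one [k] serves them all. *)
    by move: i; near: k; exact: filter_forall near_ell_u.
  by move: i x0 theta; near: k; exact: filter_forall near_ell_0.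
move: x0 theta; near: k; exact: near_terminal_cost F_N_modulus d0.
Unshelve. all: by end_near. Qed.

End pointwise_perturbation.

(** * Measurability and convergence of the averaged cost for a fixed control *)

Section fixed_control.
Context {R : realType} {X U : metricType R} {Theta : pmetricType R} {N : nat}.
Variables (f : X * U * Theta -> X) (ell ell_0 : X * U * Theta -> R).
Variables (ell_u : U -> R) (F_N : X * Theta -> R) (x0bar : Theta -> X).
Hypothesis ell_u_ge0 : forall u, 0 <= ell_u u.
Hypothesis ell_0_ge0 : forall z, 0 <= ell_0 z.
Hypothesis F_N_ge0 : forall z, 0 <= F_N z.
Hypothesis ellE : forall x u theta,
  ell (x, u, theta) = ell_u u + ell_0 (x, u, theta).
Hypothesis x0bar_continuous : continuous x0bar.
Hypothesis f_continuous : continuous f.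
Hypothesis ell_0_continuous : continuous ell_0.
Hypothesis F_N_continuous : continuous F_N.

Lemma measurable_stage_cost (u : 'I_N -> U) (n : 'I_N) :
  measurable_fun setT (fun theta : borel Theta =>
    ell_0 (trajectory f u (x0bar theta) theta n, u n, theta)).
Proof.
apply: continuous_borel_measurable => theta.
apply: (@cvg_comp _ _ _ (fun t => (trajectory f u (x0bar t) t n, u n, t))).
  exact: cvg_pair (cvg_pair
    (@continuous_trajectory _ _ _ _ _ f x0bar u n f_continuous
      x0bar_continuous theta)
    (cvg_cst (u n))) cvg_id.
exact: ell_0_continuous.
Qed.

Lemma measurable_terminal_cost (u : 'I_N -> U) :
  measurable_fun setT (fun theta : borel Theta =>
    F_N (trajectory f u (x0bar theta) theta N, theta)).
Proof.
apply: continuous_borel_measurable => theta.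
apply: (@cvg_comp _ _ _ (fun t => (trajectory f u (x0bar t) t N, t))).
  exact: cvg_pair
    (@continuous_trajectory _ _ _ _ _ f x0bar u N f_continuous
      x0bar_continuous theta) cvg_id.
exact: F_N_continuous.
Qed.

Lemma total_cost_ge0 (u : 'I_N -> U) x0 theta :
  0 <= total_cost f ell F_N x0 u theta.
Proof.
by rewrite addr_ge0 ?F_N_ge0// sumr_ge0// => i _; rewrite ellE addr_ge0.
Qed.

Lemma measurable_total_cost (u : 'I_N -> U) :
  measurable_fun setT (fun theta : borel Theta =>
    total_cost f ell F_N (x0bar theta) u theta).
Proof.
apply: measurable_funD; last exact: measurable_terminal_cost.
apply: measurable_sum => i; under eq_fun do rewrite ellE.
by apply: measurable_funD => //; exact: measurable_stage_cost.
Qed.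

(** Nonnegativity allows the integral to be split even when it is infinite. The term [ell_u (u n)]
    is constant in [theta] and [nu] has mass one, so it comes out unchanged. *)
Lemma averaged_costE (u : 'I_N -> U) (nu : probability (borel Theta) R) :
  averaged_cost f ell F_N x0bar u nu =
  (\sum_(n < N) ((ell_u (u n))%:E +
     \int[nu]_theta
       (ell_0 (trajectory f u (x0bar theta) theta n, u n, theta))%:E) +
   \int[nu]_theta (F_N (trajectory f u (x0bar theta) theta N, theta))%:E)%E.
Proof.
rewrite /averaged_cost.
under eq_integral do rewrite /total_cost EFinD -sumEFin.
have mell (n : 'I_N) : measurable_fun setT (EFin \o (fun theta : borel Theta =>
    ell (trajectory f u (x0bar theta) theta n, u n, theta))).
  apply/measurable_EFinP; under eq_fun do rewrite ellE.
  by apply: measurable_funD => //; exact: measurable_stage_cost.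
have ell_ge0 z : 0 <= ell z by case: z => [[x w] t]; rewrite ellE addr_ge0.
rewrite ge0_integralD//; last 4 first.
- by move=> t _; apply: sume_ge0 => n _; rewrite lee_fin.
- exact: emeasurable_sum.
- by move=> t _; rewrite lee_fin.
- by apply/measurable_EFinP; exact: measurable_terminal_cost.
congr (_ + _)%E; rewrite ge0_integral_sum//; last first.
  by move=> n t _; rewrite lee_fin.
apply: eq_bigr => n _; under eq_integral do rewrite ellE EFinD.
rewrite ge0_integralD//; last 3 first.
- by move=> t _; rewrite lee_fin.
- by move=> t _; rewrite lee_fin.
- by apply/measurable_EFinP; exact: measurable_stage_cost.
by rewrite integral_cst//= probability_setT mule1.
Qed.

Lemma averaged_cost_cvg (u : 'I_N -> U)
    (mu_ : nat -> probability (borel Theta) R)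
    (mu : probability (borel Theta) R) :
  (forall n : 'I_N,
     (\int[mu_ k]_theta
        (ell_0 (trajectory f u (x0bar theta) theta n, u n, theta))%:E)%E
       @[k --> \oo] -->
     (\int[mu]_theta
        (ell_0 (trajectory f u (x0bar theta) theta n, u n, theta))%:E)%E) ->
  (\int[mu_ k]_theta
     (F_N (trajectory f u (x0bar theta) theta N, theta))%:E)%E
    @[k --> \oo] -->
  (\int[mu]_theta
     (F_N (trajectory f u (x0bar theta) theta N, theta))%:E)%E ->
  averaged_cost f ell F_N x0bar u (mu_ k) @[k --> \oo] -->
  averaged_cost f ell F_N x0bar u mu.
Proof.
move=> cvg_ell_0 cvg_F_N; rewrite averaged_costE.
under eq_fun do rewrite averaged_costE.
have int_ge0 (nu : probability (borel Theta) R) (n : 'I_N) :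
    (0 <= \int[nu]_theta (ell_0 (trajectory f u (x0bar theta) theta n, u n, theta))%:E)%E.
  by apply: integral_ge0 => t _; rewrite lee_fin.
(* Limits add in [\bar R] unless infinities of opposite signs meet: nonnegativity excludes this
   here, and finiteness of [ell_u (u n)] excludes it in the inner sums. *)
apply: cvgeD => //.
  rewrite ge0_adde_def// inE; last first.
    by apply: integral_ge0 => t _; rewrite lee_fin.
  by apply: sume_ge0 => n _; rewrite adde_ge0// lee_fin.
apply: cvg_nnesum => n _.
  by apply: nearW => k; rewrite adde_ge0// lee_fin.
by apply: cvgeD; [exact: fin_num_adde_defr|exact: cvg_cst|exact: cvg_ell_0].
Qed.

End fixed_control.

(** * Recovery sequence and lower limit inequality for the averaged costs *)

Theorem theorem9 (R : realType) (X U : metricType R) (Theta : pmetricType R)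
  (N : nat) (hN : (0 < N)%N)
  (f : X * U * Theta -> X)
  (ell : X * U * Theta -> R) (ell_u : U -> R) (ell_0 : X * U * Theta -> R)
  (F_N : X * Theta -> R)
  (ell_u_ge0 : forall u, 0 <= ell_u u)
  (ell_0_ge0 : forall z, 0 <= ell_0 z)
  (F_N_ge0 : forall z, 0 <= F_N z)
  (ellE : forall x u theta,
     ell (x, u, theta) = ell_u u + ell_0 (x, u, theta))
  (mu : probability (borel Theta) R)
  (mu_ : nat -> probability (borel Theta) R)
  (mu_cvg : weakly_converges mu_ mu)
  (x0bar : Theta -> X)
  (H1 : exists alpha_x alpha_u : R -> R,
     [/\ class_Kinfty alpha_x, class_Kinfty alpha_u
       & forall (theta : Theta) (x x' : X) (u u' : U),
           mdist (f (x, u, theta)) (f (x', u', theta)) <=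
             alpha_x (mdist x x') + alpha_u (mdist u u')])
  (H2i : exists gamma_x gamma_u : R -> R,
     [/\ class_Kinfty gamma_x, class_Kinfty gamma_u
       & forall (x x' : X) (u u' : U) (theta : Theta),
           `|ell_0 (x, u, theta) - ell_0 (x', u', theta)| <=
             gamma_x (mdist x x') + gamma_u (mdist u u')])
  (H2ii : lower_semicontinuous (fun u => (ell_u u)%:E))
  (H2iii : exists2 gamma_N : R -> R, class_Kinfty gamma_N
     & forall (x x' : X) (theta : Theta),
         `|F_N (x, theta) - F_N (x', theta)| <= gamma_N (mdist x x'))
  (H3_x0bar : continuous x0bar)
  (H3_f : continuous f)
  (H3_ell_0 : continuous ell_0)
  (H3_F_N : continuous F_N)
  (H4_ell_0 : forall (u : 'I_N -> U) (n : 'I_N),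
     (\int[mu_ k]_theta
        (ell_0 (trajectory f u (x0bar theta) theta n, u n, theta))%:E)%E
       @[k --> \oo] -->
     (\int[mu]_theta
        (ell_0 (trajectory f u (x0bar theta) theta n, u n, theta))%:E)%E)
  (H4_F_N : forall u : 'I_N -> U,
     (\int[mu_ k]_theta
        (F_N (trajectory f u (x0bar theta) theta N, theta))%:E)%E
       @[k --> \oo] -->
     (\int[mu]_theta
        (F_N (trajectory f u (x0bar theta) theta N, theta))%:E)%E) :
  @Gamma_converges R {ptws 'I_N -> U}
    (fun k u => averaged_cost f ell F_N x0bar u (mu_ k))
    (fun u => averaged_cost f ell F_N x0bar u mu).
Proof.
have avg_cvg (u : 'I_N -> U) := averaged_cost_cvg ell_u_ge0 ell_0_ge0 F_N_ge0
  ellE H3_x0bar H3_f H3_ell_0 H3_F_N (H4_ell_0 u) (H4_F_N u).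
split=> [u v vu|u]; last first.
  by exists (fun=> u); [exact: cvg_cst|rewrite (cvg_limn_einf_sup (avg_cvg u))].
(* Coordinate projections are continuous for the product topology. *)
have vui i : v k i @[k --> \oo] --> u i.
  by apply: (cvg_comp _ (proj i) vu); exact: (@proj_continuous _ (fun=> U)).
case: H1 => alpha_x [alpha_u [Kx Ku f_modulus]].
case: H2i => gamma_x [gamma_u [Kgx Kgu ell_0_modulus]].
case: H2iii => gamma_N KN F_N_modulus.
apply/lee_addgt0Pr => e e0.
(* The average of [u] under [mu] becomes the lower limit of its averages under [mu_ k], and [e]
   moves inside the other lower limit. Both controls are then compared under the same measure. *)
rewrite -(cvg_limn_einf_sup (avg_cvg u)).1 addeC -limn_einf_shift//.
apply: le_limn_einf_near; have := near_total_cost vui Kx Ku f_modulus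
  Kgx Kgu KN ellE H2ii ell_0_modulus F_N_modulus e0.
move=> /(_ _); apply: filterS => k cost_le.
have mcost (w : 'I_N -> U) :=
  measurable_total_cost ellE H3_x0bar H3_f H3_ell_0 H3_F_N w.
have cost_ge0 :=
  @total_cost_ge0 _ _ _ _ N f _ _ _ _ ell_u_ge0 ell_0_ge0 F_N_ge0 ellE.
(* As [mu_ k] has mass one, [e] is itself an integral, and the comparison reduces to the pointwise
   bound [cost_le]. *)
have -> : e%:E = (\int[mu_ k]_(theta in setT) e%:E)%E.
  by rewrite integral_cst//= probability_setT mule1.
rewrite -ge0_integralD//.
- apply: ge0_le_integral => //.
  + by move=> t _; rewrite lee_fin.
  + exact/measurable_EFinP.
  + by apply/measurable_EFinP/measurable_funD.
  + by move=> t _; rewrite -EFinD lee_fin addrC cost_le.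
- by move=> t _; rewrite lee_fin ltW.
- by move=> t _; rewrite lee_fin.
- exact/measurable_EFinP.
Qed.
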